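(* Let $m,n\ge1$, let $A_1,\dots,A_m$ be $n\times n$ complex matrices, let $Q$ be an $n\times n$ Hermitian positive definite matrix, and let $X$ be the (unique) Hermitian positive definite solution of $X-\sum_{i=1}^mA_i^*X^{-1}A_i=Q$. Let $\widetilde X$ be a Hermitian positive definite matrix (an approximation to $X$), and put $$R(\widetilde X)=Q+\sum_{i=1}^mA_i^*\widetilde X^{-1}A_i-\widetilde X,\qquad \Sigma=\sum_{i=1}^m\|\widetilde X^{-1}A_i\|^2.$$ If $\Sigma<1$ and $$\|R(\widetilde X)\|<\frac{(1-\Sigma)^2}{1+\Sigma+2\sqrt{\Sigma}}\,\lambda_{\min}(\widetilde X),$$ then $$\|\widetilde X-X\|\le\theta\,\|R(\widetilde X)\|,$$ where $$\theta=\frac{2\lambda_{\min}(\widetilde X)}{(1-\Sigma)\lambda_{\min}(\widetilde X)+\|R(\widetilde X)\|+\sqrt{\left((1-\Sigma)\lambda_{\min}(\widetilde X)+\|R(\widetilde X)\|\right)^2-4\lambda_{\min}(\widetilde X)\|R(\widetilde X)\|}}.$$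
   Context: $\|\cdot\|$ is the spectral norm, $A^*$ the conjugate transpose, and $\lambda_{\min}(M)$ the smallest eigenvalue of a Hermitian matrix $M$. For every choice of $n\times n$ complex $A_i$ and Hermitian positive definite $Q$, the equation $X-\sum_{i=1}^m A_i^*X^{-1}A_i=Q$ has exactly one Hermitian positive definite solution. *)

(* Defs.v *)
From mathcomp Require Import all_boot all_order all_algebra.
From mathcomp Require Import all_classical all_reals.
From mathcomp Require Import complex.

Set Implicit Arguments.
Unset Strict Implicit.
Unset Printing Implicit Defensive.

Import Order.TTheory GRing.Theory Num.Theory.

Local Open Scope ring_scope.
Local Open Scope classical_set_scope.
Local Open Scope complex_scope.
Local Open Scope sesquilinear_scope.

Definition vnorm2 (R : realType) (n : nat) (x : 'cV[R[i]]_n) : R :=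
  Num.sqrt (\sum_(k < n) ComplexField.Normc.normc (x k 0) ^+ 2).

(* For n = 0 the set is empty and the value is the junk value [sup set0 = 0]. *)
Definition specnorm (R : realType) (n : nat) (A : 'M[R[i]]_n) : R :=
  sup [set vnorm2 (A *m x) | x in [set x : 'cV[R[i]]_n | vnorm2 x = 1]].

(* A Hermitian matrix with n > 0 has a finite nonempty set of eigenvalues, all
   real, so this infimum is attained. [eigenvalue] refers to row eigenvectors,
   which gives the same spectrum as column eigenvectors. *)
Definition lambda_min (R : realType) (n : nat) (M : 'M[R[i]]_n) : R :=
  inf [set l : R | eigenvalue M l%:C].

(* On R[i], [0 < z] means that z is real and positive. *)
Definition hermposdef (R : realType) (n : nat) (M : 'M[R[i]]_n) : Prop :=
  M \is hermsymmx /\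
  forall x : 'cV[R[i]]_n, x != 0 -> 0 < (x ^t* *m M *m x) 0 0.

Definition residual (R : realType) (m n : nat) (A : 'I_m -> 'M[R[i]]_n)
    (Q Y : 'M[R[i]]_n) : 'M[R[i]]_n :=
  Q + \sum_(k < m) (A k) ^t* *m invmx Y *m A k - Y.

Definition Sigma (R : realType) (m n : nat) (A : 'I_m -> 'M[R[i]]_n)
    (Y : 'M[R[i]]_n) : R :=
  \sum_(k < m) specnorm (invmx Y *m A k) ^+ 2.

Definition theta (R : realType) (s l r : R) : R :=
  2 * l /
  ((1 - s) * l + r + Num.sqrt (((1 - s) * l + r) ^+ 2 - 4 * l * r)).

(* Main.v *)
(** Write [F Y = Q + sum_k A_k^* Y^-1 A_k], so that [X] is a positive definite
    fixed point of [F] and the residual is [F Xt - Xt]. Expanding [Y^-1] twice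
    around [Xt], any [Y] with [||Y - Xt|| <= e < l = lambda_min Xt] satisfies
    [||F Y - Xt|| <= r + s (e + e^2 / (l - e))]. The right-hand side equals [e]
    when [e] is the smaller root of [e^2 - ((1 - s) l + r) e + l r], which is
    [theta r]; the hypothesis on [r] makes the discriminant positive, as
    it reads [r < (1 - sqrt s)^2 l]. Hence all iterates [F^k Xt] stay in the ball of radius [theta r]
    around [Xt]. On the other hand [F] contracts Thompson's metric towards [X]:
    if [X / (1 + c) <= Y <= (1 + c) X] and [d X <= Q], then the same holds for
    [F Y] with [(1 - d) c] in place of [c]. So [F^k Xt] tends to [X], and [X]
    lies in the ball. Operator inequalities and norms of Hermitian matrices are
    handled through real-valued quadratic forms. *)
Require Import Defs.
From mathcomp Require Import all_boot all_order all_algebra.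
From mathcomp Require Import all_classical all_reals.
From mathcomp Require Import spectral complex ring lra.

Set Implicit Arguments.
Unset Strict Implicit.
Unset Printing Implicit Defensive.

Import Order.TTheory GRing.Theory Num.Theory.

Local Open Scope ring_scope.
Local Open Scope complex_scope.
Local Open Scope sesquilinear_scope.

(** * Real inner product on complex column vectors *)

Section RealInnerProduct.
Variables (R : realType) (n : nat).
Implicit Types (x y z : 'cV[R[i]]_n) (M : 'M[R[i]]_n) (a : R).

(** The real part makes the Hermitian product a symmetric real bilinear form, so later inequalities
    are stated over [R] and real arithmetic applies. *)
Definition rip x y : R := complex.Re ((x ^t* *m y) 0 0).

Lemma trmxC_mul p q s (A : 'M[R[i]]_(p, q)) (B : 'M[R[i]]_(q, s)) :
  (A *m B) ^t* = B ^t* *m A ^t*.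
Proof. by rewrite trmx_mul map_mxM. Qed.

Lemma trmxCD p q (A B : 'M[R[i]]_(p, q)) : (A + B) ^t* = A ^t* + B ^t*.
Proof. by rewrite raddfD /= map_mxD. Qed.

Lemma trmxCN p q (A : 'M[R[i]]_(p, q)) : (- A) ^t* = - A ^t*.
Proof. by rewrite raddfN /= map_mxN. Qed.

Lemma trmxCZ p q (a : R) (A : 'M[R[i]]_(p, q)) : (a%:C *: A) ^t* = a%:C *: A ^t*.
Proof.
rewrite linearZ /= map_mxZ; congr (_ *: _).
by apply: conj_Creal; rewrite complex_real.
Qed.

Lemma trmxC_sum p q (I : finType) (F : I -> 'M[R[i]]_(p, q)) :
  (\sum_i F i) ^t* = \sum_i (F i) ^t*.
Proof. by rewrite raddf_sum /= map_mx_sum. Qed.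

Lemma ReD (u v : R[i]) : complex.Re (u + v) = complex.Re u + complex.Re v.
Proof. by case: u v => [? ?] [? ?]. Qed.

Lemma ReN (u : R[i]) : complex.Re (- u) = - complex.Re u.
Proof. by case: u. Qed.

Lemma ReZ a (u : R[i]) : complex.Re (a%:C * u) = a * complex.Re u.
Proof. by case: u => [b c]; rewrite /= mul0r subr0. Qed.

Lemma ripDl x y z : rip (x + y) z = rip x z + rip y z.
Proof. by rewrite /rip trmxCD mulmxDl mxE ReD. Qed.

Lemma ripDr x y z : rip x (y + z) = rip x y + rip x z.
Proof. by rewrite /rip mulmxDr mxE ReD. Qed.

Lemma ripNl x y : rip (- x) y = - rip x y.
Proof. by rewrite /rip trmxCN mulNmx mxE ReN. Qed.

Lemma ripNr x y : rip x (- y) = - rip x y.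
Proof. by rewrite /rip mulmxN mxE ReN. Qed.

Lemma ripZl a x y : rip (a%:C *: x) y = a * rip x y.
Proof. by rewrite /rip trmxCZ -scalemxAl mxE ReZ. Qed.

Lemma ripZr a x y : rip x (a%:C *: y) = a * rip x y.
Proof. by rewrite /rip -scalemxAr mxE ReZ. Qed.

Definition ripE := (ripDl, ripDr, ripNl, ripNr, ripZl, ripZr).

Lemma rip0r x : rip x 0 = 0.
Proof. by rewrite /rip mulmx0 mxE. Qed.

Lemma ripC x y : rip x y = rip y x.
Proof.
rewrite /rip -[in LHS](trmxCK y) -trmxC_mul !mxE.
by case: (\sum_(_ < _) _).
Qed.

Lemma rip_adj M x y : rip x (M *m y) = rip (M ^t* *m x) y.
Proof. by rewrite /rip trmxC_mul trmxCK mulmxA. Qed.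

Lemma ripxx x : rip x x = vnorm2 x ^+ 2.
Proof.
rewrite sqr_sqrtr; last by apply: sumr_ge0 => k _; exact: sqr_ge0.
rewrite /rip mxE (big_morph _ ReD (erefl (complex.Re 0))).
apply: eq_bigr => k _; rewrite !mxE; case: (x k 0) => [a b] /=.
by rewrite sqr_sqrtr ?addr_ge0 ?sqr_ge0// mulNr opprK -!expr2.
Qed.

Lemma vnorm2_ge0 x : 0 <= vnorm2 x.
Proof. exact: sqrtr_ge0. Qed.

Lemma ripxx_ge0 x : 0 <= rip x x.
Proof. by rewrite ripxx sqr_ge0. Qed.

Lemma ripxx_gt0 x : x != 0 -> 0 < rip x x.
Proof.
apply: contraNT; rewrite -leNgt => xx_le0.
have xx0 : rip x x = 0 by apply/le_anti; rewrite xx_le0 ripxx_ge0.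
have: vnorm2 x == 0 by rewrite -sqrf_eq0 -ripxx xx0.
rewrite sqrtr_eq0 => sum_le0.
have sum0 : \sum_k ComplexField.Normc.normc (x k 0) ^+ 2 = 0.
  by apply/le_anti; rewrite sum_le0 sumr_ge0 // => k _; exact: sqr_ge0.
apply/eqP/matrixP => k j; rewrite ord1 mxE; apply: ComplexField.Normc.eq0_normc.
apply/eqP; rewrite -sqrf_eq0.
by rewrite (psumr_eq0P _ sum0) // => ? _; exact: sqr_ge0.
Qed.

Lemma vnorm2_gt0 x : x != 0 -> 0 < vnorm2 x.
Proof.
by move=> /ripxx_gt0; rewrite ripxx exprn_even_gt0 //= lt_def vnorm2_ge0 andbT.
Qed.

(* The weighted AM-GM form of the Cauchy-Schwarz inequality avoids square roots. *)
Lemma rip_amgm (t : R) x y : 2 * t * rip x y <= t ^+ 2 * rip x x + rip y y.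
Proof.
have := ripxx_ge0 (t%:C *: x - y); rewrite !ripE (ripC y x).
move: (rip x x) (rip x y) (rip y y) => a b c; lra.
Qed.
End RealInnerProduct.

(** * Quadratic forms of Hermitian matrices and the order on inverses *)

Section QuadraticForms.
Variables (R : realType) (n : nat).
Implicit Types (x y u v : 'cV[R[i]]_n) (M E P Y : 'M[R[i]]_n) (a t : R).

Definition qform M x : R := rip x (M *m x).

Lemma qformD M P x : qform (M + P) x = qform M x + qform P x.
Proof. by rewrite /qform mulmxDl ripDr. Qed.

Lemma qformN M x : qform (- M) x = - qform M x.
Proof. by rewrite /qform mulNmx ripNr. Qed.

Lemma qformB M P x : qform (M - P) x = qform M x - qform P x.
Proof. by rewrite qformD qformN. Qed.

Lemma qform_sum (I : finType) (F : I -> 'M[R[i]]_n) x :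
  qform (\sum_i F i) x = \sum_i qform (F i) x.
Proof.
rewrite (big_morph (fun M => qform M x) (fun M P => qformD M P x) (_ : _ = 0)) //.
by rewrite /qform mul0mx rip0r.
Qed.

Lemma qform_conj M B x : qform (B ^t* *m M *m B) x = qform M (B *m x).
Proof. by rewrite /qform -!mulmxA rip_adj trmxCK. Qed.

Lemma rip_herm M : M ^t* = M -> forall x y, rip x (M *m y) = rip (M *m x) y.
Proof. by move=> hM x y; rewrite rip_adj hM. Qed.

(* Polarization with [y = t^-1 E x]. *)
Lemma herm_sqr_le E t : E ^t* = E -> 0 <= t ->
  (forall x, `|qform E x| <= t * rip x x) ->
  forall x, rip (E *m x) (E *m x) <= t ^+ 2 * rip x x.
Proof.
move=> hE t_ge0 Et x.
have bound u v : 2 * rip (E *m u) v <= t * (rip u u + rip v v).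
  have := Et (u + v); have := Et (u - v).
  rewrite /qform !mulmxDr !mulmxN !ripE !ler_norml.
  rewrite (ripC v u) (ripC v (E *m u)) (rip_herm hE u v).
  move: (rip u u) (rip v v) (rip (E *m u) u) (rip (E *m v) v) (rip (E *m u) v).
  by move=> a b c d e /andP[? ?] /andP[? ?]; lra.
move: t_ge0; rewrite le_eqVlt => /predU1P[t0|t_gt0].
  have := bound x (E *m x); rewrite -t0 expr0n !mul0r; lra.
have := bound x (t^-1%:C *: (E *m x)); rewrite !ripE.
set N := rip (E *m x) _; set q := rip x x => h.
rewrite -ler_pdivrMl ?exprn_gt0 // -(ler_pM2l t_gt0).
rewrite (_ : t * (t ^- 2 * N) = t^-1 * N); last first.
  by field; rewrite gt_eqF.
rewrite (_ : t * (q + t^-1 * (t^-1 * N)) = t * q + t^-1 * N) in h; last first.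
  by field; rewrite gt_eqF.
lra.
Qed.

(** AM-GM with weights [t] and [-t] bounds [2 t (qform M x)] on both sides by [2 t^2 (rip x x)], and
    [t] cancels. For [t = 0] the hypothesis forces [M x = 0]. *)
Lemma qform_le_of_sqr M t : 0 <= t ->
  (forall x, rip (M *m x) (M *m x) <= t ^+ 2 * rip x x) ->
  forall x, `|qform M x| <= t * rip x x.
Proof.
move=> t_ge0 Mt x; have := Mt x.
move: t_ge0; rewrite le_eqVlt => /predU1P[<-|t_gt0].
  rewrite expr0n !mul0r => Mx_le0; rewrite /qform.
  have [->|/ripxx_gt0] := eqVneq (M *m x) 0; first by rewrite rip0r normr0.
  by rewrite ltNge Mx_le0.
move=> h; have := rip_amgm t x (M *m x); have := rip_amgm (- t) x (M *m x).
rewrite -/(qform M x) sqrrN ler_norml.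
move: (qform M x) (rip x x) (rip (M *m x) _) h => a b c h h1 h2.
by apply/andP; split; rewrite -(ler_pM2l t_gt0); nra.
Qed.

(** Real-valued counterpart of [hermposdef], whose positivity is stated in the order of [R[i]]. *)
Definition hpd M : Prop := M ^t* = M /\ forall x, x != 0 -> 0 < qform M x.

Lemma hermsymmxE M : M \is hermsymmx -> M ^t* = M.
Proof. by move/is_hermitianmxP => {2}->; rewrite expr0 scale1r. Qed.

Lemma hermposdef_hpd M : hermposdef M -> hpd M.
Proof.
move=> [/hermsymmxE hM M_gt0]; split => // x /M_gt0.
by rewrite ltcE /= -mulmxA => /andP[].
Qed.

Lemma hpd_ge0 M x : hpd M -> 0 <= qform M x.
Proof.
move=> [_ M_gt0]; have [->|/M_gt0/ltW //] := eqVneq x 0.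
by rewrite /qform mulmx0 rip0r.
Qed.

Lemma hpd_unitmx M : hpd M -> M \in unitmx.
Proof.
move=> [hM M_gt0]; rewrite unitmxE unitfE; apply/negP => /det0P[v v_neq0 vM0].
(* [v] is a row in the left kernel; as [M] is Hermitian, its adjoint is a column in the right
   kernel. *)
have : v ^t* != 0.
  apply: contraNneq v_neq0 => v0; rewrite -(trmxCK v) v0.
  by rewrite trmx0 map_mx0.
move=> /M_gt0; rewrite /qform -{1}hM -trmxC_mul vM0 trmx0 map_mx0 rip0r.
by rewrite ltxx.
Qed.

Lemma trmxC_inv M : M ^t* = M -> (invmx M) ^t* = invmx M.
Proof. by move=> hM; rewrite trmx_inv map_invmx hM. Qed.

Lemma qform_inv M x : hpd M -> qform (invmx M) x = qform M (invmx M *m x).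
Proof.
move=> Mpd; rewrite {2}/qform mulmxA mulmxV ?hpd_unitmx // mul1mx.
exact: ripC.
Qed.

Lemma qform_inv_ge0 M x : hpd M -> 0 <= qform (invmx M) x.
Proof. by move=> Mpd; rewrite qform_inv // hpd_ge0. Qed.

(* With [w = Y^-1 v], this is positivity of [P] at [a w - P^-1 v]. *)
Lemma qform_inv_antitone a P Y v : 0 < a -> hpd P -> hpd Y ->
  (forall x, a * qform P x <= qform Y x) ->
  a * qform (invmx Y) v <= qform (invmx P) v.
Proof.
move=> a_gt0 Ppd Ypd aPY.
have Pz : P *m (invmx P *m v) = v by rewrite mulmxA mulmxV ?hpd_unitmx // mul1mx.
have Yw : Y *m (invmx Y *m v) = v by rewrite mulmxA mulmxV ?hpd_unitmx // mul1mx.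
rewrite /qform; move: (invmx P *m v) (invmx Y *m v) Pz Yw => z w Pz Yw.
have := aPY w; have := hpd_ge0 (a%:C *: w - z) Ppd.
rewrite /qform mulmxBr Pz Yw -scalemxAr !ripE (ripC w v).
rewrite (rip_herm (proj1 Ppd) z) Pz (ripC z v).
move: (rip w _) (rip v w) (rip v z) => p q r; nra.
Qed.

Lemma qform_inv_le a Y v : 0 < a -> hpd Y ->
  (forall x, a * rip x x <= qform Y x) -> a * qform (invmx Y) v <= rip v v.
Proof.
move=> a_gt0 Ypd aY.
have q1 x : qform 1%:M x = rip x x by rewrite /qform mul1mx.
have I_hpd : hpd 1%:M.
  split=> [|x]; last by rewrite q1; exact: ripxx_gt0.
  by rewrite trmx1 map_mx1.
rewrite -(q1 v) -[X in _ <= qform X v]invmx1; apply: qform_inv_antitone => // x.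
by rewrite q1.
Qed.

End QuadraticForms.

(** * Least eigenvalues and the spectral norm *)

Section SpectralNorm.
Variables (R : realType) (n : nat).
Hypothesis n_gt0 : (0 < n)%N.
Implicit Types (x : 'cV[R[i]]_n) (A M Y : 'M[R[i]]_n) (a t : R).

(** After unitary diagonalization, the least diagonal entry is an eigenvalue and bounds the form
    from below, coordinate by coordinate. *)
Lemma herm_min_eigenvalue M : M ^t* = M ->
  exists2 l : R, eigenvalue M l%:C & forall x, l * rip x x <= qform M x.
Proof.
move=> hM.
have Mherm : M \is hermsymmx.
  by apply/is_hermitianmxP; rewrite expr0 scale1r hM.
have /orthomx_spectralP := hermitian_normalmx Mherm.
have Pu := spectral_unitarymx M; have := hermitian_spectral_diag_real Mherm.
move: (spectralmx M) (spectral_diag M) Pu => P d Pu d_real.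
rewrite (invmx_unitary Pu) => MPd.
have dE k : d 0 k = (complex.Re (d 0 k))%:C.
  by rewrite RRe_real // (mxOverP d_real).
pose i0 := Ordinal n_gt0.
have [k _ k_min] := arg_minP (fun k => complex.Re (d 0 k)) (erefl : predT i0).
exists (complex.Re (d 0 k)).
  have PPt : P *m P ^t* = 1%:M by apply/unitarymxP.
  apply/eigenvalueP; exists (row k P).
    rewrite MPd -row_mul !mulmxA PPt mul1mx row_mul row_diag_mx -scalemxAl.
    by rewrite -rowE dE.
  apply: contraTneq isT => Pk0; have /matrixP/(_ k k) := PPt.
  rewrite !mxE eqxx (eq_bigr (fun=> 0)); first by rewrite big1_eq => /eqP; rewrite eq_sym oner_eq0.
  by move=> j _; move/rowP/(_ j): Pk0; rewrite !mxE => ->; rewrite mul0r.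
move=> x; rewrite MPd qform_conj.
have -> : rip x x = rip (P *m x) (P *m x).
  rewrite rip_adj mulmxA -(invmx_unitary Pu) mulVmx ?mul1mx //.
  exact: unitarymx_unit.
move: (P *m x) => y.
have Reprod (z : R[i]) : complex.Re (z^* * z)%R = ComplexField.Normc.normc z ^+ 2.
  by case: z => a b /=; rewrite sqr_sqrtr ?addr_ge0 ?sqr_ge0 // mulNr opprK -!expr2.
rewrite ripxx sqr_sqrtr; last by apply: sumr_ge0 => j _; exact: sqr_ge0.
rewrite /qform /rip mxE (big_morph _ (@ReD R) (erefl (complex.Re 0))) mulr_sumr.
apply: ler_sum => j _; rewrite mul_diag_mx !mxE (dE j) [in leRHS]mulrCA ReZ Reprod.
by rewrite ler_wpM2r ?sqr_ge0 // k_min.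
Qed.

Lemma eigenvalue_qform M (l : R) : M ^t* = M -> eigenvalue M l%:C ->
  exists2 x, x != 0 & qform M x = l * rip x x.
Proof.
move=> hM /eigenvalueP[v vM v_neq0]; exists (v ^t*).
  by apply: contraNneq v_neq0 => v0; rewrite -(trmxCK v) v0 trmx0 map_mx0.
by rewrite /qform -{1}hM -trmxC_mul vM trmxCZ ripZr.
Qed.

Lemma hpd_eigenvalue_gt0 M (l : R) : hpd M -> eigenvalue M l%:C -> 0 < l.
Proof.
move=> [hM M_gt0] /(eigenvalue_qform hM)[x x_neq0 Mx].
by have := M_gt0 x x_neq0; rewrite Mx pmulr_lgt0 // ripxx_gt0.
Qed.

Lemma hpd_coercive M : hpd M -> exists2 l : R, 0 < l &
  forall x, l * rip x x <= qform M x.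
Proof.
move=> Mpd; have [l evl l_le] := herm_min_eigenvalue (proj1 Mpd).
by exists l; first exact: hpd_eigenvalue_gt0 evl.
Qed.

Lemma lambda_min_le M x : hpd M -> lambda_min M * rip x x <= qform M x.
Proof.
move=> Mpd; have [l evl l_le] := herm_min_eigenvalue (proj1 Mpd).
apply: le_trans (l_le x); apply: ler_wpM2r; first exact: ripxx_ge0.
by apply: ge_inf => //; exists 0 => k /= /(hpd_eigenvalue_gt0 Mpd)/ltW.
Qed.

Lemma vnorm2Z a x : 0 <= a -> vnorm2 (a%:C *: x) = a * vnorm2 x.
Proof.
move=> a_ge0; apply: (@pexpIrn _ 2) => //; rewrite ?nnegrE ?mulr_ge0 ?vnorm2_ge0 //.
by rewrite exprMn -!ripxx !ripE mulrA -expr2.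
Qed.

Lemma specnorm_set_nonempty A :
  ([set vnorm2 (A *m x) | x in [set x | vnorm2 x = 1]] !=set0)%classic.
Proof.
pose x : 'cV[R[i]]_n := delta_mx (Ordinal n_gt0) 0.
have x_neq0 : x != 0.
  apply/eqP => /matrixP/(_ (Ordinal n_gt0) 0); rewrite !mxE !eqxx => /eqP.
  by rewrite oner_eq0.
have x_gt0 := vnorm2_gt0 x_neq0.
exists (vnorm2 (A *m ((vnorm2 x)^-1%:C *: x))); eexists => //=.
by rewrite vnorm2Z ?invr_ge0 ?vnorm2_ge0 // mulVf // gt_eqF.
Qed.

(** If [l] is the least eigenvalue of [- A^* A], then [||A x||^2 <= - l] on unit vectors, hence
    [||A x|| <= 1 + |l|]. *)
Lemma specnorm_has_ubound A :
  has_ubound [set vnorm2 (A *m x) | x in [set x | vnorm2 x = 1]]%classic.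
Proof.
have hAA : (- (A ^t* *m A)) ^t* = - (A ^t* *m A).
  by rewrite trmxCN trmxC_mul trmxCK.
have [l _ l_le] := herm_min_eigenvalue hAA.
exists (1 + `|l|) => _ [x /= x1 <-].
have := l_le x; rewrite qformN -[A ^t*]mulmx1 qform_conj /qform mul1mx !ripxx x1.
have := vnorm2_ge0 (A *m x); have := ler_norm (- l); rewrite normrN; have := normr_ge0 l.
nra.
Qed.

Lemma specnorm_ge0 A : 0 <= specnorm A.
Proof.
have [_ [x /= x1 _]] := specnorm_set_nonempty A.
apply: le_trans (vnorm2_ge0 (A *m x)) _.
by apply: (ub_le_sup (specnorm_has_ubound A)); exists x.
Qed.

Lemma specnorm_sqr_le A x :
  rip (A *m x) (A *m x) <= specnorm A ^+ 2 * rip x x.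
Proof.
have [->|x_neq0] := eqVneq x 0; first by rewrite mulmx0 rip0r mulr0.
have x_gt0 := vnorm2_gt0 x_neq0.
rewrite !ripxx -exprMn ler_pXn2r ?nnegrE ?mulr_ge0 ?vnorm2_ge0 ?specnorm_ge0 //.
rewrite -ler_pdivrMr // mulrC.
rewrite -vnorm2Z ?invr_ge0 ?vnorm2_ge0 // scalemxAr.
apply: (ub_le_sup (specnorm_has_ubound A)); eexists => //=.
by rewrite vnorm2Z ?invr_ge0 ?vnorm2_ge0 // mulVf // gt_eqF.
Qed.

Lemma specnorm_le A t : 0 <= t ->
  (forall x, rip (A *m x) (A *m x) <= t ^+ 2 * rip x x) -> specnorm A <= t.
Proof.
move=> t_ge0 At; apply: ge_sup; first exact: specnorm_set_nonempty.
move=> _ [x /= x1 <-]; have := At x; rewrite !ripxx x1 expr1n mulr1.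
by rewrite ler_pXn2r ?nnegrE ?vnorm2_ge0.
Qed.

(** The form of [A] is at most [||A||] and that of [M] at least some [l > 0] on unit vectors; the
    added 1 keeps [c] positive when [A = 0]. *)
Lemma hpd_dominates M A : hpd M ->
  exists2 c : R, 0 < c & forall x, qform A x <= c * qform M x.
Proof.
move=> Mpd; have [l l_gt0 l_le] := hpd_coercive Mpd.
have A_ge0 := specnorm_ge0 A.
exists ((specnorm A + 1) / l); first by rewrite divr_gt0 // ltr_wpDl.
move=> x; have := qform_le_of_sqr A_ge0 (specnorm_sqr_le A) x.
rewrite ler_norml => /andP[_ Ax]; rewrite mulrAC ler_pdivlMr //.
have := l_le x; have := ripxx_ge0 x.
by move: (specnorm A) (qform A x) (qform M x) (rip x x) A_ge0 Ax => s p q r; nra.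
Qed.
End SpectralNorm.

(** * The fixed-point map: Thompson contraction and stability of a ball *)

Section FixedPointIteration.
Variables (R : realType) (m n : nat).
Hypothesis n_gt0 : (0 < n)%N.
Variables (A : 'I_m -> 'M[R[i]]_n) (Q : 'M[R[i]]_n).
Hypothesis Qpd : hpd Q.
Implicit Types (x v : 'cV[R[i]]_n) (X Y Z : 'M[R[i]]_n) (c d e l r s : R).

Definition fpmap Y : 'M[R[i]]_n := Q + \sum_(k < m) (A k) ^t* *m invmx Y *m A k.

Lemma qform_fpmap Y x :
  qform (fpmap Y) x = qform Q x + \sum_(k < m) qform (invmx Y) (A k *m x).
Proof.
by rewrite qformD qform_sum; congr (_ + _); apply: eq_bigr => k _; exact: qform_conj.
Qed.

Lemma fpmap_hpd Y : hpd Y -> hpd (fpmap Y).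
Proof.
move=> Ypd; split=> [|x x_neq0].
  rewrite trmxCD (proj1 Qpd) trmxC_sum; congr (_ + _); apply: eq_bigr => k _.
  by rewrite !trmxC_mul trmxCK trmxC_inv ?mulmxA //; case: Ypd.
rewrite qform_fpmap ltr_pwDl ?(proj2 Qpd) // sumr_ge0 // => k _.
exact: qform_inv_ge0.
Qed.

(** Inversion reverses the order, so [Z <= (1 + c) Y] gives [Y^-1 <= (1 + c) Z^-1]. *)
Lemma sum_qform_inv_le c Y Z x : 0 <= c -> hpd Y -> hpd Z ->
  (forall v, qform Z v <= (1 + c) * qform Y v) ->
  \sum_(k < m) qform (invmx Y) (A k *m x) <=
  (1 + c) * \sum_(k < m) qform (invmx Z) (A k *m x).
Proof.
move=> c_ge0 Ypd Zpd ZY; have c1_gt0 : 0 < 1 + c by rewrite ltr_pwDl.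
rewrite mulr_sumr; apply: ler_sum => k _.
rewrite -ler_pdivrMl //; apply: qform_inv_antitone; rewrite ?invr_gt0 // => v.
by rewrite ler_pdivrMl.
Qed.

(* Closeness of [X] and [Y] in Thompson's metric, with [1 + c] the exponential of
   the distance. *)
Definition thompson_close X c Y : Prop := forall x,
  qform X x <= (1 + c) * qform Y x /\ qform Y x <= (1 + c) * qform X x.

(** Only the share [sX] of [qX] is perturbed, and [qQ] takes up at least the fraction [d]. Thus
    [qQ + sY <= qX + c (qX - qQ)], and conversely [(1 + c) (qQ + sY) >= qX + c qQ >= (1 + c d)
    qX]. *)
Lemma thompson_arith c d (qX qQ sX sY : R) : 0 <= c -> 0 <= d <= 1 ->
  0 <= qX -> d * qX <= qQ -> qX = qQ + sX ->
  sY <= (1 + c) * sX -> sX <= (1 + c) * sY ->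
  qX <= (1 + (1 - d) * c) * (qQ + sY) /\ qQ + sY <= (1 + (1 - d) * c) * qX.
Proof.
move=> c_ge0 /andP[d_ge0 d_le1] qX_ge0 dqX qXE sY_le sX_le.
have cdqX : 0 <= c * (qQ - d * qX) by rewrite mulr_ge0 // subr_ge0.
split; last by subst qX; nra.
have c1_gt0 : 0 < 1 + c by rewrite ltr_pwDl.
have d1c_ge0 : 0 <= (1 - d) * c by rewrite mulr_ge0 // subr_ge0.
have lower : (1 + c * d) * qX <= (1 + c) * (qQ + sY) by nra.
rewrite -(ler_pM2l c1_gt0) mulrCA.
(* The product of [1 + (1 - d) c] and [1 + c d] exceeds [1 + c] by the nonnegative
   [(1 - d) c^2 d]. *)
have -> : (1 + c) * qX =
  (1 + (1 - d) * c) * ((1 + c * d) * qX) - (1 - d) * c * c * d * qX by ring.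
rewrite lerBlDr; apply: le_trans (ler_wpM2l _ lower) _; first by rewrite addr_ge0.
by rewrite lerDl !mulr_ge0 // subr_ge0.
Qed.

Lemma fpmap_thompson_contraction X Y c d : hpd X -> hpd Y -> fpmap X = X ->
  0 <= c -> 0 <= d <= 1 -> (forall x, d * qform X x <= qform Q x) ->
  thompson_close X c Y -> thompson_close X ((1 - d) * c) (fpmap Y).
Proof.
move=> Xpd Ypd FX c_ge0 d01 dXQ XY x.
have sY := sum_qform_inv_le x c_ge0 Ypd Xpd (fun v => proj1 (XY v)).
have sX := sum_qform_inv_le x c_ge0 Xpd Ypd (fun v => proj2 (XY v)).
have := qform_fpmap X x; rewrite FX => qXE; rewrite qform_fpmap.
exact: thompson_arith c_ge0 d01 (hpd_ge0 x Xpd) (dXQ x) qXE sY sX.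
Qed.

Lemma thompson_close_exists X Y : hpd X -> hpd Y ->
  exists2 c : R, 0 <= c & thompson_close X c Y.
Proof.
move=> Xpd Ypd.
have [a a_gt0 XY] := hpd_dominates n_gt0 X Ypd.
have [b b_gt0 YX] := hpd_dominates n_gt0 Y Xpd.
exists (a + b) => [|x]; first by rewrite addr_ge0 ?ltW.
have := XY x; have := YX x; have := hpd_ge0 x Xpd; have := hpd_ge0 x Ypd.
by move: (qform X x) (qform Y x) => p q ? ? ? ?; split; nra.
Qed.

(* Two applications of [X^-1 - Y^-1 = X^-1 (Y - X) Y^-1]. *)
Lemma qform_inv_expand X Y v : hpd X -> hpd Y ->
  qform (invmx Y) v = qform (invmx X) v - qform (Y - X) (invmx X *m v)
    + qform (invmx Y) ((Y - X) *m (invmx X *m v)).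
Proof.
move=> Xpd Ypd; have [hX _] := Xpd; have [hY _] := Ypd.
have resolvent : invmx Y *m (Y - X) *m invmx X = invmx X - invmx Y.
  rewrite mulmxBr mulVmx ?hpd_unitmx // mulmxBl mul1mx -mulmxA.
  by rewrite mulmxV ?hpd_unitmx // mulmx1.
have resolvent' : invmx X *m (Y - X) *m invmx Y = invmx X - invmx Y.
  rewrite mulmxBr mulVmx ?hpd_unitmx // mulmxBl mul1mx -mulmxA.
  by rewrite mulmxV ?hpd_unitmx // mulmx1.
have hV := trmxC_inv hX.
have hE : (Y - X) ^t* = Y - X by rewrite trmxCD trmxCN hX hY.
rewrite mulmxA -[qform (Y - X) _]qform_conj -[qform _ (_ *m _ *m v)]qform_conj.
rewrite -qformN -!qformD trmxC_mul hV hE; congr qform.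
move: (Y - X) (invmx X) (invmx Y) resolvent resolvent' => E V W resolvent resolvent'.
rewrite resolvent' !mulmxA (mulmxBl V) mulmxBl resolvent.
by rewrite addrA subrK opprB addrC subrK.
Qed.

(** Here [X] is the approximate solution, the centre of the ball. In the expansion of [Y^-1], the
    first-order term costs [e] and the second [e^2 / (l - e)], because [Y >= l - e]. Both are taken
    at [X^-1 A_k x], whose squared norms sum to at most [Sigma A X] times that of [x]. *)
Lemma fpmap_ball X Y e l r : hpd X -> hpd Y -> 0 <= e < l ->
  (forall x, l * rip x x <= qform X x) ->
  (forall x, `|qform (residual A Q X) x| <= r * rip x x) ->
  (forall x, `|qform (Y - X) x| <= e * rip x x) ->
  forall x, `|qform (fpmap Y - X) x| <=
    (r + Sigma A X * (e + e ^+ 2 / (l - e))) * rip x x.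
Proof.
move=> Xpd Ypd /andP[e_ge0 e_lt_l] lX rX eY x.
have hE : (Y - X) ^t* = Y - X by rewrite trmxCD trmxCN (proj1 Xpd) (proj1 Ypd).
have le_gt0 : 0 < l - e by rewrite subr_gt0.
have leY v : (l - e) * rip v v <= qform Y v.
  rewrite -[Y](subrK X) qformD; have := eY v; have := lX v.
  rewrite ler_norml.
  by move: (qform _ v) (qform X v) (rip v v) => p q u ? /andP[? _]; lra.
set f := e + _.
have f_ge0 : 0 <= f by rewrite addr_ge0 // mulr_ge0 ?sqr_ge0 ?invr_ge0 ?ltW.
have term v : `|qform (Y - X) v - qform (invmx Y) ((Y - X) *m v)| <= f * rip v v.
  apply: le_trans (ler_normB _ _) _; rewrite mulrDl lerD //.
  rewrite ger0_norm ?qform_inv_ge0 // mulrAC ler_pdivlMr // mulrC.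
  apply: le_trans (qform_inv_le _ le_gt0 Ypd leY) _.
  exact: herm_sqr_le.
pose g k := qform (Y - X) (invmx X *m (A k *m x))
  - qform (invmx Y) ((Y - X) *m (invmx X *m (A k *m x))).
have sumE : \sum_(k < m) qform (invmx Y) (A k *m x) =
    \sum_(k < m) qform (invmx X) (A k *m x) - \sum_(k < m) g k.
  rewrite -sumrB; apply: eq_bigr => k _.
  by rewrite (qform_inv_expand (A k *m x) Xpd Ypd) /g opprB addrCA addrC.
have resE : qform (residual A Q X) x = qform (fpmap X) x - qform X x.
  exact: qformB.
have -> : qform (fpmap Y - X) x = qform (residual A Q X) x - \sum_(k < m) g k.
  apply: etrans (qformB _ _ _) _.
  have /= -> := congr1 (fun u => u - qform X x) (qform_fpmap Y x).
  rewrite sumE resE (qform_fpmap X).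
  rewrite addrA; exact: addrAC.
apply: le_trans (ler_normB _ _) _; rewrite mulrDl lerD //.
apply: le_trans (ler_norm_sum _ _ _) _.
rewrite /Sigma !mulr_suml; apply: ler_sum => k _.
apply: le_trans (term _) _; rewrite mulrAC mulrC; apply: ler_wpM2r => //.
rewrite mulmxA; exact: specnorm_sqr_le.
Qed.

End FixedPointIteration.

(** * Scalar estimates: the radius of the ball and a geometric limit *)

Lemma theta_radius (R : realType) (s l r : R) : 0 <= s < 1 -> 0 <= r ->
  r < (1 - s) ^+ 2 / (1 + s + 2 * Num.sqrt s) * l ->
  let e := theta s l r * r in
  0 <= e < l /\ r + s * (e + e ^+ 2 / (l - e)) = e.
Proof.
move=> /andP[s_ge0 s_lt1] r_ge0.
set w := Num.sqrt s; have sE : s = w ^+ 2 by rewrite sqr_sqrtr.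
have w_ge0 : 0 <= w := sqrtr_ge0 _.
have w_lt1 : w < 1 by rewrite sE in s_lt1; nra.
(* With [s = w^2], the denominator is [(1 + w)^2] and the numerator [(1 - w)^2 (1 + w)^2]. *)
have -> : (1 - s) ^+ 2 / (1 + s + 2 * w) = (1 - w) ^+ 2.
  rewrite sE; field; rewrite gt_eqF //; nra.
move=> r_lt /=.
have w1_gt0 : 0 < (1 - w) ^+ 2 by rewrite exprn_gt0 // subr_gt0.
have l_gt0 : 0 < l by rewrite -(pmulr_rgt0 _ w1_gt0) (le_lt_trans r_ge0).
rewrite /theta; set b := (1 - s) * l + r.
have disc_gt0 : 0 < b ^+ 2 - 4 * l * r.
  have -> : b ^+ 2 - 4 * l * r =
    ((1 - w) ^+ 2 * l - r) * ((1 + w) ^+ 2 * l - r) by rewrite /b sE; ring.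
  rewrite mulr_gt0 // ?subr_gt0 // (lt_le_trans r_lt) // ler_wpM2r ?(ltW l_gt0) //.
  by rewrite ler_pXn2r ?nnegrE //; lra.
set D := Num.sqrt _.
have D_gt0 : 0 < D by rewrite sqrtr_gt0.
have DE : D ^+ 2 = b ^+ 2 - 4 * l * r by rewrite sqr_sqrtr // ltW.
have b_gt0 : 0 < b by rewrite ltr_wpDr // mulr_gt0 // subr_gt0.
(* Rationalization by [(b - D) (b + D) = 4 l r] shows that [theta r] is the smaller root of the
   quadratic. *)
have eE : 2 * l / (b + D) * r = (b - D) / 2.
  apply: (@mulfI _ (2 * (b + D))); first by rewrite gt_eqF // mulr_gt0 // addr_gt0.
  rewrite (_ : _ * ((b - D) / 2) = b ^+ 2 - D ^+ 2); last by field.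
  by rewrite DE; field; rewrite gt_eqF // addr_gt0.
have e_ge0 : 0 <= 2 * l / (b + D) * r.
  apply: mulr_ge0 => //; apply: divr_ge0; apply: ltW; first exact: mulr_gt0.
  exact: addr_gt0.
rewrite e_ge0; move: e_ge0; rewrite eE; set e := _ / 2 => e_ge0.
have e_root : e ^+ 2 = b * e - l * r.
  have -> : l * r = (b ^+ 2 - D ^+ 2) / 4 by rewrite DE; field.
  by rewrite /e; field.
(* The bound on [r] gives [b < 2 (1 - w) l <= 2 l], and [D > 0]. *)
have e_lt : e < l.
  rewrite /e ltr_pdivrMr // /b sE; nra.
split=> //.
(* Since [e + e^2 / (l - e) = e l / (l - e)], clearing the denominator turns the fixed-point
   equation into the quadratic. *)
have le_neq0 : l - e != 0 by rewrite gt_eqF // subr_gt0.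
apply: (mulIf le_neq0).
rewrite (_ : _ * (l - e) = r * (l - e) + s * e * l); last by field.
rewrite (_ : e * (l - e) = e * l - e ^+ 2); last by ring.
by rewrite e_root /b; ring.
Qed.

(* Bernoulli: [(1 - d)^k (1 + k d) <= 1]. *)
Lemma le_of_geometric (R : realType) (a b g d : R) : 0 < d <= 1 -> 0 <= g ->
  (forall k : nat, a <= b + (1 - d) ^+ k * g) -> a <= b.
Proof.
move=> /andP[d_gt0 d_le1] g_ge0 abk; rewrite leNgt; apply/negP => b_lt_a.
have bern (k : nat) : (1 - d) ^+ k * (1 + k%:R * d) <= 1.
  elim: k => [|k IH]; first by rewrite expr0 mul0r addr0 mulr1.
  apply: le_trans IH; rewrite exprSr -mulrA ler_wpM2l ?exprn_ge0 ?subr_ge0 //.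
  rewrite -natr1; have := ler0n R k; nra.
have ab_gt0 : 0 < a - b by rewrite subr_gt0.
(* This [k] makes [k d (a - b)] exceed [g], whereas Bernoulli gives [(a - b) (1 + k d) <= g]. *)
pose k := Num.bound (g / (d * (a - b))).
have k_gt : g < k%:R * d * (a - b).
  rewrite -mulrA -ltr_pdivrMr ?mulr_gt0 //.
  by apply: le_lt_trans (archi_boundP _); rewrite ?ler_norm // divr_ge0 // mulr_ge0 // ltW.
have := bern k; have := abk k.
have : 0 <= (1 - d) ^+ k by rewrite exprn_ge0 // subr_ge0.
have kd_ge0 : 0 <= k%:R * d by rewrite mulr_ge0 // ltW.
move: ((1 - d) ^+ k) => p p_ge0 abp pk.
have : (a - b) * (1 + k%:R * d) <= p * g * (1 + k%:R * d).
  by rewrite ler_wpM2r ?addr_ge0 // lerBlDl.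
have : p * g * (1 + k%:R * d) <= g by rewrite mulrAC ler_piMl.
nra.
Qed.

Theorem theorem5p1 (R : realType) (m n : nat) (hm : (1 <= m)%N)
  (hn : (1 <= n)%N) (A : 'I_m -> 'M[R[i]]_n) (Q X Xt : 'M[R[i]]_n)
  (hQ : hermposdef Q) (hX : hermposdef X)
  (hXeq : X - \sum_(k < m) (A k) ^t* *m invmx X *m A k = Q)
  (hXt : hermposdef Xt)
  (hSigma : Sigma A Xt < 1)
  (hR : specnorm (residual A Q Xt)
        < (1 - Sigma A Xt) ^+ 2
          / (1 + Sigma A Xt + 2 * Num.sqrt (Sigma A Xt)) * lambda_min Xt) :
  specnorm (Xt - X)
  <= theta (Sigma A Xt) (lambda_min Xt) (specnorm (residual A Q Xt))
     * specnorm (residual A Q Xt).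
Proof.
have Qpd := hermposdef_hpd hQ; have Xpd := hermposdef_hpd hX.
have Xtpd := hermposdef_hpd hXt.
have FX : fpmap A Q X = X by rewrite /fpmap -hXeq subrK.
have s01 : 0 <= Sigma A Xt < 1 by rewrite hSigma sumr_ge0 // => k _; exact: sqr_ge0.
have r_ge0 := specnorm_ge0 hn (residual A Q Xt).
have rX := qform_le_of_sqr r_ge0 (specnorm_sqr_le hn (residual A Q Xt)).
have := theta_radius s01 r_ge0 hR.
set e := theta _ _ _ * _ => /= -[e_bounds e_fix].
have /andP[e_ge0 _] := e_bounds.
have [c c_gt0 XQ] := hpd_dominates hn X Qpd.
(* [X <= c Q] gives [d X <= Q]; the added 1 ensures [d <= 1]. *)
pose d : R := (1 + c)^-1.
have c1_gt0 : 0 < 1 + c by rewrite addr_gt0.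
have d01 : 0 < d <= 1 by rewrite invr_gt0 c1_gt0 invf_le1 // lerDl ltW.
have dXQ x : d * qform X x <= qform Q x.
  rewrite ler_pdivrMl //; apply: le_trans (XQ x) _.
  by rewrite ler_wpM2r ?hpd_ge0 // lerDr.
have [g g_ge0 Xg] := thompson_close_exists hn Xpd Xtpd.
pose Y k := iter k (fpmap A Q) Xt.
have Y_close k : [/\ hpd (Y k), (forall x, `|qform (Y k - Xt) x| <= e * rip x x)
    & thompson_close X ((1 - d) ^+ k * g) (Y k)].
  elim: k => [|k [Ypd Ye YX]].
    split=> [//|x|]; last by rewrite expr0 mul1r.
    by rewrite subrr /qform mul0mx rip0r normr0 mulr_ge0 ?ripxx_ge0.
  have /andP[d_gt0 d_le1] := d01.
  split=> [|x|]; first exact: fpmap_hpd.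
    rewrite -[in leRHS]e_fix; apply: fpmap_ball => // {}x; exact: lambda_min_le.
  rewrite exprS -mulrA; apply: fpmap_thompson_contraction => //.
    by rewrite mulr_ge0 // exprn_ge0 // subr_ge0.
  by rewrite ltW.
have hE : (Xt - X) ^t* = Xt - X by rewrite trmxCD trmxCN (proj1 Xtpd) (proj1 Xpd).
(* For Hermitian [Xt - X] the norm bound reduces to a bound on its form. At a fixed [x], comparison
   with [Y k] leaves an error [(1 - d)^k g (qform X x)], which vanishes in the limit. *)
apply: (specnorm_le hn e_ge0); apply: herm_sqr_le => // x.
apply: (le_of_geometric d01 (mulr_ge0 g_ge0 (hpd_ge0 x Xpd))) => k.
have [Ypd /(_ x) Ye /(_ x)] := Y_close k; rewrite mulrA.
have p_ge0 : 0 <= (1 - d) ^+ k * g.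
  by rewrite mulr_ge0 // exprn_ge0 // subr_ge0; case/andP: d01.
move: Ye; rewrite !qformB.
move: (hpd_ge0 x Xpd) (hpd_ge0 x Ypd).
move: ((1 - d) ^+ k * g) (qform X x) (qform (Y k) x) (qform Xt x) (e * rip x x) p_ge0.
move=> p qX qY qXt b p_ge0 qX_ge0 qY_ge0; rewrite !ler_norml => /andP[? ?] [XY YX].
apply/andP; split; last by lra.
(* Closeness gives [qX - qY <= p qY]; the error must be [p qX], which does not depend on the
   iterate. If [qX <= qY] the difference is nonpositive, otherwise [p qY <= p qX]. *)
have [qXY|/ltW qYX] := leP qX qY; first by have := mulr_ge0 p_ge0 qX_ge0; lra.
have := ler_wpM2l p_ge0 qYX; lra.
Qed.
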